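(* Let $\mathbb D$ be a Banach space with norm $\|\cdot\|_{\mathbb D}$ and let $\mathbb E=\mathbf R$. Let $\mathbb D_0\subseteq\mathbb D$, $\mathbb D_\phi\subseteq\mathbb D$, $\theta_0\in\mathbb D_\phi$, $\phi:\mathbb D_\phi\to\mathbf R$, and $\alpha\in(0,1)$. Suppose: (1) $\phi$ is Hadamard directionally differentiable at $\theta_0$ tangentially to $\mathbb D_0$, and its derivative $\phi'_{\theta_0}:\mathbb D_0\to\mathbf R$ can be extended to a continuous map on all of $\mathbb D$ (also denoted $\phi'_{\theta_0}$). (2) There are maps $\hat\theta_n:\{X_i\}_{i=1}^n\to\mathbb D_\phi$ and scalars $r_n\uparrow\infty$ with $r_n\{\hat\theta_n-\theta_0\}\stackrel{L}{\rightarrow}\mathbb G_0$ in $\mathbb D$, where $\mathbb G_0$ is tight and its support is included in $\mathbb D_0$. (3) $\hat\theta_n^*:\{X_i,W_i\}_{i=1}^n\to\mathbb D_\phi$ with $\{W_i\}_{i=1}^n$ independent of $\{X_i\}_{i=1}^n$, and $\sup_{f\in \mathrm{BL}_1(\mathbb D)}|E[f(r_n\{\hat\theta_n^*-\hat\theta_n\})|\{X_i\}_{i=1}^n]-E[f(\mathbb G_0)]|=o_p(1)$. (4) The sequence $r_n\{\hat\theta_n^*-\hat\theta_n\}$ is asymptotically measurable (jointly in $\{X_i,W_i\}_{i=1}^n$), and for every continuous bounded $f:\mathbb D\to\mathbf R$, $f(r_n\{\hat\theta_n^*-\hat\theta_n\})$ is a measurable function of $\{W_i\}_{i=1}^n$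 outer almost surely in $\{X_i\}_{i=1}^n$. (5) $\hat\phi_n':\mathbb D\to\mathbf R$ is a function of $\{X_i\}_{i=1}^n$ such that for every compact $K\subseteq\mathbb D_0$, with $K^\delta\equiv\{a\in\mathbb D:\inf_{b\in K}\|a-b\|_{\mathbb D}<\delta\}$, and every $\epsilon>0$, $\lim_{\delta\downarrow0}\limsup_{n\to\infty}P(\sup_{h\in K^\delta}|\hat\phi_n'(h)-\phi'_{\theta_0}(h)|>\epsilon)=0$. Define $$\hat c_{1-\alpha}\equiv\inf\{c:P(\hat\phi_n'(r_n\{\hat\theta_n^*-\hat\theta_n\})\le c\,|\{X_i\}_{i=1}^n)\ge1-\alpha\}.$$ If the cdf of $\phi'_{\theta_0}(\mathbb G_0)$ is continuous and strictly increasing at its $1-\alpha$ quantile, denoted $c_{1-\alpha}$, then $\hat c_{1-\alpha}\stackrel{p}{\to}c_{1-\alpha}$.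
   Context: Banach spaces are over the reals. A map $\phi:\mathbb D_\phi\subseteq\mathbb D\to\mathbb E$ is Hadamard directionally differentiable at $\theta\in\mathbb D_\phi$ tangentially to $\mathbb D_0\subseteq\mathbb D$ if there is a continuous (not necessarily linear) map $\phi'_\theta:\mathbb D_0\to\mathbb E$ such that $\lim_{n}\|\{\phi(\theta+t_nh_n)-\phi(\theta)\}/t_n-\phi'_\theta(h)\|_{\mathbb E}=0$ for all $\{h_n\}\subset\mathbb D$, $\{t_n\}\subset\mathbf R_+$ with $t_n\downarrow0$, $h_n\to h\in\mathbb D_0$ and $\theta+t_nh_n\in\mathbb D_\phi$ for all $n$. $\{X_i\}_{i=1}^n$ is the data and $\{W_i\}_{i=1}^n$ are random weights; $\hat\theta_n:\{X_i\}_{i=1}^n\to\mathbb D_\phi$ means $\hat\theta_n$ is a (not necessarily measurable) $\mathbb D_\phi$-valued function of the data, and similarly for $\hat\theta_n^*$. ''$\hat\phi_n'$ is a function of $\{X_i\}_{i=1}^n$'' means that $\hat\phi_n'$ is a data-dependent map $\mathbb D\to\mathbb E$ (not depending on the weights). Convergence in distribution $\stackrel{L}{\to}$ is in the Hoffman-Jørgensen sense: $Z_n\stackrel{L}{\to}Z$ ($Z$ Borel) means $E^*[f(Z_n)]\to E[f(Z)]$ for all bounded continuous real $f$, where $E^*$ is outer expectation ($E_*$ inner expectation). Expectations and probabilities of possibly nonmeasurable objects are outer ones; $o_p(1)$ and $\stackrel{p}{\to}$ refer to convergence in outer probability. $E[\,\cdot\,|\{X_i\}_{i=1}^n]$ and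 $P(\,\cdot\,|\{X_i\}_{i=1}^n)$ denote outer expectation/probability with respect to the joint law of $\{W_i\}_{i=1}^n$ treating the data as constant. $Z_n$ is asymptotically measurable if $E^*[f(Z_n)]-E_*[f(Z_n)]\to0$ for all bounded continuous $f$. For a normed space $\mathbf A$, $\mathrm{BL}_1(\mathbf A)=\{f:\mathbf A\to\mathbf R:\ |f(a)|\le1,\ |f(a)-f(a')|\le\|a-a'\|_{\mathbf A}\ \forall a,a'\in\mathbf A\}$. $\mathbb G_0$ is a Borel random element of $\mathbb D$. The $1-\alpha$ quantile is $c_{1-\alpha}=\inf\{c:P(\phi'_{\theta_0}(\mathbb G_0)\le c)\ge1-\alpha\}$. *)

(* Defs.v *)
From HB Require Import structures.
From mathcomp Require Export all_boot all_order all_algebra.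
From mathcomp Require Export all_classical all_reals all_analysis measurable_realfun.
Export Order.TTheory GRing.Theory Num.Theory.
Export numFieldNormedType.Exports.

Set Implicit Arguments.
Unset Strict Implicit.
Unset Printing Implicit Defensive.

Local Open Scope classical_set_scope.
Local Open Scope ring_scope.
Local Open Scope ereal_scope.

(* Partial maps phi : Dphi -> E and dphi : D0 -> E are encoded by total maps
   whose values off Dphi (resp. D0) are irrelevant. *)
Definition hadamard_directional_derivative (R : realType)
    (D E : normedModType R) (Dphi D0 : set D) (phi : D -> E) (theta : D)
    (dphi : D -> E) : Prop :=
  {within D0, continuous dphi} /\
  forall (h : nat -> D) (t : nat -> R) (h0 : D),
    (forall n, 0 < t n)%R -> nonincreasing_seq t -> t @ \oo --> (0 : R)%R ->
    D0 h0 -> h @ \oo --> h0 ->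
    (forall n, Dphi (theta + t n *: h n)%R) ->
    (fun n => `| (t n)^-1 *: (phi (theta + t n *: h n) - phi theta)
                 - dphi h0 |)%R @ \oo --> (0 : R)%R.

Section outer.
Context (R : realType) (d : measure_display) (T : measurableType d)
  (P : probability T R).

(* [integral] is total, so that the existence of the expectation of a
   majorant has to be required explicitly. *)
Definition has_expectation (U : T -> \bar R) : Prop :=
  \int[P]_x U^\+ x < +oo \/ \int[P]_x U^\- x < +oo.

Definition outer_expectation (Z : T -> \bar R) : \bar R :=
  ereal_inf [set \int[P]_x U x | U in
    [set U : T -> \bar R | [/\ measurable_fun setT U, has_expectation U &
                               forall x, Z x <= U x]]].

Definition inner_expectation (Z : T -> \bar R) : \bar R :=
  - outer_expectation (fun x => - Z x).

Definition outer_probability (A : set T) : \bar R :=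
  ereal_inf [set P B | B in [set B | measurable B /\ A `<=` B]].

Definition cvg_in_outer_probability (Y : nat -> T -> \bar R) (c : \bar R) :
    Prop :=
  forall e : R, (0 < e)%R ->
    (fun n => outer_probability [set x | e%:E < `| Y n x - c |]) @ \oo --> 0.

Definition asymptotically_measurable (D : normedModType R) (Z : nat -> T -> D) :
    Prop :=
  forall f : D -> R, continuous f -> bounded_fun f ->
    (fun n => outer_expectation (fun x => (f (Z n x))%:E)
              - inner_expectation (fun x => (f (Z n x))%:E)) @ \oo --> 0.

End outer.

Definition borel (R : realType) (D : normedModType R) :=
  g_sigma_algebraType (@open D).

Definition borel_random_element (R : realType) (D : normedModType R)
    (d : measure_display) (T : measurableType d) (G : T -> D) : Prop :=
  measurable_fun setT (G : T -> borel D).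

Definition weakly_converges (R : realType) (D : normedModType R)
    (d : measure_display) (T : measurableType d) (P : probability T R)
    (d0 : measure_display) (T0 : measurableType d0) (P0 : probability T0 R)
    (Z : nat -> T -> D) (G : T0 -> D) : Prop :=
  forall f : D -> R, continuous f -> bounded_fun f ->
    (fun n => outer_expectation P (fun x => (f (Z n x))%:E)) @ \oo -->
    \int[P0]_t (f (G t))%:E.

Section random_element.
Context (R : realType) (D : normedModType R) (d : measure_display)
  (T : measurableType d) (P : probability T R) (G : T -> D).

Definition tight : Prop :=
  forall e : R, (0 < e)%R ->
    exists2 K : set D, compact K & (1 - e)%:E <= P (G @^-1` K).

Definition support : set D :=
  [set a | forall U : set D, open U -> U a -> 0 < P (G @^-1` U)].

End random_element.

Definition BL1 (R : realType) (D : normedModType R) : set (D -> R) :=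
  [set f | (forall a, `|f a| <= 1)%R /\
           (forall a b, `|f a - f b| <= `|a - b|)%R].

(* Extended-real infimum: the enlargement of the empty set is empty. *)
Definition enlargement (R : realType) (D : normedModType R) (K : set D)
    (delta : R) : set D :=
  [set a | ereal_inf [set `|a - b|%R%:E | b in K] < delta%:E].

Definition independent_RV (R : realType) (d d1 d2 : measure_display)
    (T : measurableType d) (T1 : measurableType d1) (T2 : measurableType d2)
    (P : probability T R) (X : {mfun T >-> T1}) (Y : {mfun T >-> T2}) : Prop :=
  forall (A : set T1) (B : set T2), measurable A -> measurable B ->
    P (X @^-1` A `&` Y @^-1` B) = P (X @^-1` A) * P (Y @^-1` B).

(* Extended-real valued: with the outer probabilities of nonmeasurable events
   the set of admissible c need not be bounded below. *)
Definition quantile (R : realType) (F : R -> \bar R) (p : R) : \bar R :=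
  ereal_inf [set c%:E | c in [set c | p%:E <= F c]].

Definition strictly_increasing_at (R : realType) (F : R -> R) (c : R) : Prop :=
  \forall x \near c,
    ((x < c)%R -> (F x < F c)%R) /\ ((c < x)%R -> (F c < F x)%R).

(* Main.v *)
(* For open U the functions min(s, d(., U^c)) are 1-Lipschitz minorants of
   s 1_U, and their mean under G0, divided by s, tends to P(G0 in U) as s
   tends to 0.  Closeness of the conditional bootstrap law to
   the law of G0 in the bounded Lipschitz distance therefore bounds the
   conditional outer probability of {Z in U} below by any t < P(G0 in U), and
   that of {Z notin U} above by 1 - t.  Apply this to
   U1 = {dphi < c + e/2} and U2 = {dphi > c - e/2}, both intersected with an
   enlargement K^delta of a compact K within the support of G0 that carries
   most of its mass.  Where phi_hat is within e/2 of dphi on K^delta, Z in U1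
   forces phi_hat(Z) <= c + e, and phi_hat(Z) <= c - e forces Z notin U2, so
   that the bootstrap quantile lies in [c - e, c + e]. *)
Require Import Defs.
From mathcomp Require Import finmap lra.

Set Implicit Arguments.
Unset Strict Implicit.
Unset Printing Implicit Defensive.

Local Open Scope classical_set_scope.
Local Open Scope ring_scope.
Local Open Scope ereal_scope.

(** * Outer probability and outer expectation *)

Section outer_theory.
Context (R : realType) (d : measure_display) (T : measurableType d)
  (P : probability T R).

(* [measureU2] and [le_measure], restated so that [P] occurs through its
   [probability] coercion and equations on [P] rewrite syntactically. *)
Lemma probability_setU_le (A B : set T) :
  measurable A -> measurable B -> P (A `|` B) <= P A + P B.
Proof. exact: measureU2. Qed.

Lemma le_probability (A B : set T) :
  measurable A -> measurable B -> A `<=` B -> P A <= P B.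
Proof. by move=> mA mB AB; apply: le_measure => //; exact: mem_set. Qed.

Lemma le_outer_probability (A B : set T) :
  A `<=` B -> outer_probability P A <= outer_probability P B.
Proof.
move=> AB; apply: ereal_inf_le_tmp => _ [C [mC BC] <-].
by exists C => //; split=> //; exact: subset_trans BC.
Qed.

Lemma outer_probability_ge0 (A : set T) : 0 <= outer_probability P A.
Proof. by apply: le_ereal_inf_tmp => _ [C _ <-]. Qed.

Lemma outer_probabilityU2 (A B : set T) (a b : R) :
  outer_probability P A < a%:E -> outer_probability P B < b%:E ->
  outer_probability P (A `|` B) < (a + b)%:E.
Proof.
move=> /ereal_inf_lt[_ [A' [mA' AA'] <-] PA] /ereal_inf_lt[_ [B' [mB' BB'] <-] PB].
apply: (@le_lt_trans _ _ (P (A' `|` B'))).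
  apply: ereal_inf_lbound; exists (A' `|` B') => //; split.
    exact: measurableU.
  exact: setUSS.
by rewrite EFinD (le_lt_trans (probability_setU_le _ _))// lteD.
Qed.

(** Markov's inequality applies to each measurable majorant [U] of [f]: the level set [B] of [U] is
    measurable and contains [A], so it competes in the infimum defining the outer probability of
    [A]. *)
Lemma outer_markov (A : set T) (f : T -> R) (s : R) :
  (0 < s)%R -> (forall x, 0 <= f x)%R -> (forall x, A x -> s <= f x)%R ->
  s%:E * outer_probability P A <= outer_expectation P (EFin \o f).
Proof.
move=> s0 f0 fA; apply: le_ereal_inf_tmp => _ [U [mU _ fU] <-].
have U0 x : 0 <= U x by rewrite (le_trans _ (fU x))// lee_fin.
pose B := [set x | s%:E <= U x].
have mB : measurable B.
  by rewrite -[B]setTI; exact: emeasurable_fun_c_infty.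
apply: (@le_trans _ _ (s%:E * P B)).
  rewrite lee_pmul2l ?lte_fin//; apply: ereal_inf_lbound; exists B => //.
  by split=> // x /fA Ax; apply: le_trans (fU x); rewrite lee_fin.
rewrite -integral_cst//.
apply: (@le_trans _ _ (\int[P]_(x in B) U x)).
  apply: ge0_le_integral => //.
  - by move=> x _; rewrite lee_fin ltW.
  - exact: measurable_funTS.
exact: ge0_subset_integral.
Qed.

(** Each measurable [B] containing [A] yields the measurable majorant [s * \1_B] of [f], whose
    integral is [s * P B]; the infimum is then taken over [B]. *)
Lemma outer_expectation_le (A : set T) (f : T -> R) (s : R) :
  (0 < s)%R -> (forall x, f x <= s)%R -> (forall x, ~ A x -> f x <= 0)%R ->
  outer_expectation P (EFin \o f) <= s%:E * outer_probability P A.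
Proof.
move=> s0 fs fA; rewrite -lee_pdivrMl//; apply: le_ereal_inf_tmp => _ [B [mB AB] <-].
rewrite lee_pdivrMl//; apply: ereal_inf_lbound.
have mI : measurable_fun setT (fun x => s%:E * (\1_B x)%:E).
  exact/measurable_funeM/measurable_EFinP.
have I0 x : 0 <= s%:E * (\1_B x)%:E by rewrite -EFinM lee_fin mulr_ge0// ltW.
exists (fun x => s%:E * (\1_B x)%:E); last first.
  by rewrite ge0_integralZl ?integral_indic ?setIT ?lee_fin ?ltW//;
    exact/measurable_EFinP.
split=> //.
  (* The majorant is nonnegative, so its negative part vanishes and the second alternative of
     [has_expectation] holds. *)
  right; rewrite integral0_eq// => x _; apply/eqP.
  by rewrite funenegE; apply/eqP/max_idPr; rewrite leeNl oppe0.
move=> x /=; rewrite -EFinM lee_fin indicE.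
have [xB|xB] := boolP (x \in B); first by rewrite mulr1.
by rewrite mulr0; apply: fA => /AB /mem_set; exact/negP.
Qed.

End outer_theory.

(** * Lipschitz test functions built from the distance to a set *)

Section truncated_distance.
Context (R : realType) (D : normedModType R).
Local Open Scope ring_scope.

(* The distance to [C], truncated at [s]; adding the point [s] gives the right
   value [s] when [C] is empty. *)
Definition trunc_dist (s : R) (C : set D) (x : D) : R :=
  inf ([set s] `|` [set `|x - y| | y in C]).

(** An infimum is determined by its lower bounds; the estimates on [trunc_dist] below are read off
    from this form. *)
Lemma le_trunc_dist (s t : R) (C : set D) (x : D) :
  0 <= s -> t <= trunc_dist s C x <-> t <= s /\ forall y, C y -> t <= `|x - y|.
Proof.
move=> s0; have lb : has_lbound ([set s] `|` [set `|x - y| | y in C]).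
  by exists 0 => _ [->//|[y _ <-]].
split=> [tx|[ts tC]].
  split; first by rewrite (le_trans tx)//; apply: ge_inf => //; left.
  by move=> y Cy; rewrite (le_trans tx)//; apply: ge_inf => //; right; exists y.
apply: lb_le_inf; first by exists s; left.
by move=> _ [->//|[y Cy <-]]; exact: tC.
Qed.

Lemma trunc_dist_ge0 (s : R) (C : set D) (x : D) :
  0 <= s -> 0 <= trunc_dist s C x.
Proof. by move=> s0; apply/le_trunc_dist. Qed.

Lemma trunc_dist_le (s : R) (C : set D) (x : D) :
  0 <= s -> trunc_dist s C x <= s.
Proof.
by move=> s0; case: (le_trunc_dist (trunc_dist s C x) C x s0) => /(_ (lexx _))[].
Qed.

Lemma trunc_dist_le_norm (s : R) (C : set D) (x y : D) :
  0 <= s -> C y -> trunc_dist s C x <= `|x - y|.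
Proof.
move=> s0; case: (le_trunc_dist (trunc_dist s C x) C x s0).
by move=> /(_ (lexx _))[_ + _]; apply.
Qed.

Lemma trunc_dist_lip (s : R) (C : set D) (x y : D) :
  0 <= s -> `|trunc_dist s C x - trunc_dist s C y| <= `|x - y|.
Proof.
move=> s0.
have half (a b : D) : trunc_dist s C a - `|a - b| <= trunc_dist s C b.
  apply/le_trunc_dist => //; split.
    by rewrite lerBlDr (le_trans (trunc_dist_le _ _ s0))// lerDl.
  move=> z Cz; rewrite lerBlDl (le_trans (trunc_dist_le_norm a s0 Cz))//.
  by rewrite (le_trans _ (ler_normD _ _))// addrA subrK.
have hxy := half x y; have := half y x; rewrite distrC => hyx.
by rewrite ler_norml; apply/andP; split; lra.
Qed.

Lemma lipschitz1_continuous (f : D -> R) :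
  (forall a b, `|f a - f b| <= `|a - b|) -> continuous f.
Proof.
move=> lipf x; apply/cvgrPdist_lt => e e0; near=> y.
by rewrite (le_lt_trans (lipf _ _))//; near: y; exact: cvgr_dist_lt.
Unshelve. all: by end_near. Qed.

Lemma trunc_dist_continuous (s : R) (C : set D) :
  0 <= s -> continuous (trunc_dist s C).
Proof. by move=> s0; apply: lipschitz1_continuous => a b; exact: trunc_dist_lip. Qed.

Lemma trunc_dist_BL1 (s : R) (C : set D) :
  0 <= s <= 1 -> BL1 (D := D) (trunc_dist s C).
Proof.
move=> /andP[s0 s1]; split=> [a|a b]; last exact: trunc_dist_lip.
by rewrite ger0_norm ?trunc_dist_ge0// (le_trans (trunc_dist_le _ _ s0)).
Qed.

(** This test function equals [s] on [C], and so serves to bound outer probabilities of [C] from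
    above by Markov's inequality. *)
Lemma trunc_dist_compl_BL1 (s : R) (C : set D) :
  0 <= s <= 1 -> BL1 (D := D) (fun x => s - trunc_dist s C x).
Proof.
move=> /andP[s0 s1]; split=> [a|a b].
  have := trunc_dist_ge0 C a s0; have := trunc_dist_le C a s0 => h1 h2.
  by rewrite ger0_norm; lra.
by rewrite opprB addrC addrA subrK distrC; exact: trunc_dist_lip.
Qed.

End truncated_distance.

(** * Integrals of test functions of a Borel random element *)

Section borel_random_elements.
Context (R : realType) (D : normedModType R) (d : measure_display)
  (T : measurableType d) (P : probability T R) (G : T -> D).
Hypothesis mG : borel_random_element G.

Lemma measurable_preimage_open (U : set D) : open U -> measurable (G @^-1` U).
Proof.
move=> oU; rewrite -[X in measurable X]setTI.
by apply: mG => //; exact: sub_sigma_algebra.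
Qed.

Lemma measurable_preimage_closed (C : set D) :
  closed C -> measurable (G @^-1` C).
Proof.
move=> cC; rewrite -[C]setCK -preimage_setC; apply: measurableC.
by apply: measurable_preimage_open; rewrite openC.
Qed.

Lemma measurable_continuous_comp (f : D -> R) :
  continuous f -> measurable_fun setT (f \o G).
Proof.
move=> cf; apply: (measurability _ (RGenOpens.measurableE R)) => _ [_ [a [b ->]] <-].
rewrite setTI comp_preimage; apply: measurable_preimage_open.
by apply: open_comp => // x _; exact: cf.
Qed.

Lemma integrable_BL1 (f : D -> R) :
  BL1 f -> P.-integrable setT (EFin \o (f \o G)).
Proof.
move=> [f1 lipf]; apply: measurable_bounded_integrable => //.
- exact: fin_num_fun_lty.
- exact/measurable_continuous_comp/lipschitz1_continuous.
- exists 1%R; split=> // M M1 x _ /=; exact: le_trans (f1 _) (ltW M1).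
Qed.

Lemma trunc_dist_integral_gt (U : set D) (t : R) :
  open U -> t%:E < P (G @^-1` U) ->
  exists s k : R, [/\ (0 < s <= 1)%R, (0 < k)%R &
    (s * t + k)%:E <= \int[P]_x (trunc_dist s (~` U) (G x))%:E].
Proof.
move=> oU tU.
pose s n : R := (n.+1%:R^-1)%R.
have s0 n : (0 < s n)%R by rewrite invr_gt0.
have s0' n : (0 <= s n)%R by exact: ltW.
pose A n := [set x | s n <= trunc_dist (s n) (~` U) (G x)]%R.
have mtd n : measurable_fun setT (trunc_dist (s n) (~` U) \o G).
  exact/measurable_continuous_comp/trunc_dist_continuous.
have mA n : measurable (A n).
  rewrite (_ : A n = (trunc_dist (s n) (~` U) \o G) @^-1` `[s n, +oo[%classic).
    by rewrite -[X in measurable X]setTI; apply: mtd.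
  by apply/seteqP; split=> x /=; rewrite in_itv/= andbT.
have Acup : \bigcup_n A n = G @^-1` U.
  apply/seteqP; split=> [x [n _]|x /= Ux].
    move=> /(le_trunc_dist _ _ _ (s0' n))[_ h] /=; apply: contrapT => /h.
    by rewrite subrr normr0 leNgt s0.
  have /nbhs_ballP[e /= e0 eU] : nbhs (G x) U by exact: open_nbhs_nbhs.
  have [n] := ltr_add_invr e0; rewrite add0r => ne.
  exists n => //; apply/le_trunc_dist => //; split=> // y nUy.
  rewrite leNgt; apply/negP => xy; apply: nUy; apply: eU.
  by rewrite -ball_normE /=; exact: lt_trans ne.
have Ahomo : {homo A : n m / (n <= m)%N >-> (n <= m)%O}.
  move=> n m nm; apply/subsetPset => x /(le_trunc_dist _ _ _ (s0' n))[_ h].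
  apply/le_trunc_dist => //; split=> // y /h; apply: le_trans.
  by rewrite lef_pV2 ?posrE// ler_nat.
have : (P \o A) n @[n --> \oo] --> P (\bigcup_n A n).
  apply: nondecreasing_cvg_mu => //; rewrite Acup.
  exact: measurable_preimage_open.
rewrite Acup => /(_ [set y | t%:E < y])[].
  by apply: open_nbhs_nbhs; split => //; exact: open_ereal_gt_ereal.
move=> n _ /(_ n (leqnn n)) /= tAn.
have PAfin : P (A n) \is a fin_num by exact: fin_num_measure.
(* This [k] makes [s * t + k] equal to [s n * P (A n)], a lower bound for the integral over [A n]
   alone. *)
exists (s n), (s n * (fine (P (A n)) - t))%R; split.
- by rewrite s0/= invf_le1// ler1n.
- by rewrite mulr_gt0// subr_gt0 -lte_fin fineK.
rewrite mulrBr addrC subrK EFinM fineK// -integral_cst//.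
apply: (@le_trans _ _ (\int[P]_(x in A n) (trunc_dist (s n) (~` U) (G x))%:E)).
  apply: ge0_le_integral => //.
  - by move=> x _; rewrite lee_fin.
  - exact/measurable_EFinP/measurable_funTS/mtd.
apply: ge0_subset_integral => //; first exact/measurable_EFinP/mtd.
by move=> x _; rewrite lee_fin trunc_dist_ge0.
Qed.

End borel_random_elements.

(** * A quantitative portmanteau bound for open sets *)

Section portmanteau.
Context (R : realType) (D : normedModType R) (d0 : measure_display)
  (T0 : measurableType d0) (P0 : probability T0 R) (G : T0 -> D).
Hypothesis mG : borel_random_element G.

(** The threshold [k] depends only on [U], [t] and the law of [G], so that it serves for every [n]
    and every realization of the data at once. Outer probabilities of complementary sets need not
    add up to 1; hence two test functions, [trunc_dist] for [U] and [s - trunc_dist] for its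
    complement. *)
Lemma portmanteau_open (U : set D) (t : R) :
  open U -> t%:E < P0 (G @^-1` U) ->
  exists2 k : R, (0 < k)%R &
  forall (d : measure_display) (T : measurableType d) (Q : probability T R)
    (Z : T -> D),
  ereal_sup [set `| outer_expectation Q (fun w => (f (Z w))%:E)
                    - \int[P0]_x (f (G x))%:E | | f in BL1 (D:=D)] <= k%:E ->
  t%:E <= outer_probability Q (Z @^-1` U) /\
  outer_probability Q (Z @^-1` (~` U)) <= (1 - t)%:E.
Proof.
move=> oU tU; have [s [k [s01 k0 sk]]] := trunc_dist_integral_gt mG oU tU.
have /andP[s0 s1] := s01; have s0' : (0 <= s)%R by exact: ltW.
have s01' : (0 <= s <= 1)%R by rewrite s0'.
exists k => // d T Q Z QZ.
have intf f : BL1 f -> \int[P0]_x (f (G x))%:E \is a fin_num.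
  by move=> /(integrable_BL1 P0 mG)/integrable_fin_num; exact.
have dist f : BL1 f -> `| outer_expectation Q (fun w => (f (Z w))%:E)
                    - \int[P0]_x (f (G x))%:E | <= k%:E.
  by move=> bf; rewrite (le_trans _ QZ)//; apply: ereal_sup_ubound; exists f.
have b1 := trunc_dist_BL1 (~` U) s01'.
have b2 := trunc_dist_compl_BL1 (~` U) s01'.
have int2 : \int[P0]_x (s - trunc_dist s (~` U) (G x))%:E
    = s%:E - \int[P0]_x (trunc_dist s (~` U) (G x))%:E.
  under eq_integral do rewrite EFinB.
  rewrite integralB//.
  - by rewrite integral_cst//= (@probability_setT _ _ _ P0) mule1.
  - exact: finite_measure_integrable_cst.
  - exact: integrable_BL1 b1.
have := dist _ b1; have := dist _ b2; rewrite int2.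
have := intf _ b1; move: sk.
set I := \int[P0]_x _ => + finI.
rewrite -(fineK finI) lee_fin => sk.
have E1 : outer_expectation Q (fun w => (trunc_dist s (~` U) (Z w))%:E)
    <= s%:E * outer_probability Q (Z @^-1` U).
  apply: outer_expectation_le => //.
  - by move=> x; exact: trunc_dist_le.
  - move=> x nUx; rewrite (le_trans (trunc_dist_le_norm _ s0' nUx))//.
    by rewrite subrr normr0.
have E2 : s%:E * outer_probability Q (Z @^-1` (~` U)) <=
    outer_expectation Q (fun w => (s - trunc_dist s (~` U) (Z w))%:E).
  apply: outer_markov => //.
  - by move=> x; rewrite subr_ge0 trunc_dist_le.
  - move=> x nUx; rewrite lerBrDr gerDl.
    rewrite (le_trans (trunc_dist_le_norm _ s0' nUx))//.
    by rewrite subrr normr0.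
move: E1 E2; set e1 := outer_expectation _ _; set e2 := outer_expectation _ _.
move=> E1 E2 D2 D1; split.
(* After multiplication by [s], the loss [k] in [D1] is paid by the margin in [sk]; [D1] and [D2]
   exclude infinite outer expectations. *)
- rewrite -(@lee_pmul2l _ s%:E)//.
  apply: le_trans E1; move: D1; case: e1 => [e| |]//=.
    rewrite lee_fin ler_norml => /andP[h _]; rewrite -EFinM lee_fin; lra.
- rewrite -(@lee_pmul2l _ s%:E)//.
  apply: le_trans E2 _; move: D2; case: e2 => [e| |]//=.
    rewrite lee_fin ler_norml => /andP[_ h]; rewrite -EFinM lee_fin; lra.
Qed.

End portmanteau.

(** * Compact sets inside the support of a tight law *)

Section tightness.
Context (R : realType) (D : normedModType R) (d : measure_display)
  (T : measurableType d) (P : probability T R) (G : T -> D).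
Hypothesis mG : borel_random_element G.

Lemma support_closed : closed (support P G).
Proof.
rewrite -openC (_ : ~` _ =
    \bigcup_(U in [set U | open U /\ ~ (0 < P (G @^-1` U))]) U).
  by apply: bigcup_open => U [].
apply/seteqP; split=> [a|a [U [oU PU] Ua] /(_ U oU Ua)//].
by move=> /existsNP[U /not_implyP[oU /not_implyP[Ua PU]]]; exists U.
Qed.

(** Each point of [K] has a null open neighbourhood. An arbitrary union of null sets may carry mass,
    but compactness leaves a finite subcover. *)
Lemma compact_disjoint_support_null (K : set D) :
  compact K -> K `&` support P G = set0 -> P (G @^-1` K) = 0.
Proof.
move=> cK KS.
have mK : measurable (G @^-1` K).
  by apply: measurable_preimage_closed => //; exact: compact_closed.
have KV a : K a -> exists U, [/\ open U, U a & P (G @^-1` U) = 0].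
  move=> Ka.
  have /existsNP[U /not_implyP[oU /not_implyP[Ua PU]]] : ~ support P G a.
    by move=> Sa; have : (K `&` support P G) a by []; rewrite KS.
  exists U; split=> //; apply/eqP.
  by rewrite eq_le measure_ge0 andbT leNgt; exact/negP.
move: cK; rewrite compact_cover.
move=> /(_ _ [set U : set D | open U /\ P (G @^-1` U) = 0] id)[].
- by move=> U [].
- by move=> a /KV[U [oU Ua PU]]; exists U.
move=> A AK KA; apply/eqP; rewrite eq_le measure_ge0 andbT.
(* Measurability is carried along in the induction because subadditivity asks for it. *)
have : measurable (G @^-1` \bigcup_(U in [set` A]) U) /\
    P (G @^-1` \bigcup_(U in [set` A]) U) = 0.
  rewrite bigcup_fset big_seq.
  elim/big_ind : _ => [|U V [mU U0] [mV V0]|U /AK/set_mem[oU PU]].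
  - by rewrite preimage_set0 measure0.
  - rewrite preimage_setU; split; first exact: measurableU.
    apply/eqP; rewrite eq_le measure_ge0 andbT.
    by rewrite (le_trans (probability_setU_le _ mU mV))// U0 V0 adde0.
  - by split=> //; exact: (measurable_preimage_open mG oU).
by move=> [mA <-]; apply: le_probability => // x /KA.
Qed.

(** The witness is a tightness compact cut down to the support. Its mass is measured through open
    supersets [U]: the part of the original compact outside [U] is again compact and misses the
    support, hence is null, whereas the part outside the support need not be compact. *)
Lemma tight_compact_in_support (e : R) : tight P G -> (0 < e)%R ->
  exists K : set D, [/\ compact K, K `<=` support P G &
    forall U, open U -> K `<=` U -> (1 - e)%:E <= P (G @^-1` U)].
Proof.
move=> tG e0; have [K cK PK] := tG e e0.
exists (K `&` support P G); split.
- exact: compact_closedI cK support_closed.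
- by move=> x [].
move=> U oU KU.
have mK : measurable (G @^-1` K).
  by apply: measurable_preimage_closed => //; exact: compact_closed.
have mU := measurable_preimage_open mG oU.
have cKU : compact (K `&` ~` U).
  by apply: compact_closedI => //; rewrite closedC.
have mKU : measurable (G @^-1` (K `&` ~` U)).
  by apply: measurable_preimage_closed => //; exact: compact_closed.
apply: (le_trans PK).
apply: (@le_trans _ _ (P (G @^-1` U `|` G @^-1` (K `&` ~` U)))).
  apply: le_probability => //; first exact: measurableU.
  by move=> x Kx; have [Ux|Ux] := pselect (U (G x)); [left|right].
rewrite (le_trans (probability_setU_le _ _ _))//.
rewrite (compact_disjoint_support_null cKU) ?adde0//.
by rewrite -subset0 => x [[Kx nUx] Sx]; apply: nUx; exact: KU.
Qed.

End tightness.

(** * Enlargements, and the mass of an intersection *)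

Lemma open_enlargement (R : realType) (D : normedModType R) (K : set D) (delta : R) :
  open (enlargement K delta).
Proof.
rewrite (_ : enlargement K delta = \bigcup_(b in K) ball b delta).
  by apply: bigcup_open => b _; exact: ball_open.
apply/seteqP; split=> [a /ereal_inf_lt[_ [b Kb <-]]|a [b Kb]];
  rewrite -ball_normE /=.
  by rewrite lte_fin distrC; exists b.
move=> ba; apply/ereal_inf_ltP.
by exists `|a - b|%:E; [exists b|rewrite lte_fin distrC].
Qed.

Lemma sub_enlargement (R : realType) (D : normedModType R) (K : set D) (delta : R) :
  (0 < delta)%R -> K `<=` enlargement K delta.
Proof.
move=> delta0 a Ka; apply/ereal_inf_ltP; exists 0; last by rewrite lte_fin.
by exists a => //; rewrite subrr normr0.
Qed.

Lemma le_probabilityI (R : realType) (d : measure_display) (T : measurableType d)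
    (P : probability T R) (A B : set T) (a e : R) :
  measurable A -> measurable B -> a%:E <= P A -> (1 - e)%:E <= P B ->
  (a - e)%:E <= P (A `&` B).
Proof.
move=> mA mB PA PB.
have : P A <= P (A `&` B) + P (~` B).
  rewrite (le_trans _ (probability_setU_le _ _ _))//;
    [|exact: measurableI|exact: measurableC].
  apply: le_probability => //.
    by apply: measurableU; [exact: measurableI|exact: measurableC].
  by move=> x Ax; have [Bx|Bx] := pselect (B x); [left|right].
have PABf : P (A `&` B) \is a fin_num by apply: fin_num_measure; exact: measurableI.
rewrite probability_setC//; move: PA PB.
have PBf : P B \is a fin_num by exact: fin_num_measure.
rewrite -(fineK PABf) -(fineK PBf) => PA; rewrite lee_fin => PB /(le_trans PA).
rewrite -EFinB -EFinD !lee_fin; lra.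
Qed.

(** * Quantiles of nondecreasing functions *)

Section quantiles.
Context (R : realType) (F : R -> \bar R).
Hypothesis F_nd : forall x y : R, (x <= y)%R -> F x <= F y.

(** By monotonicity no admissible point lies below [c - e], while [c + e] is admissible; in
    particular the quantile is finite. Only monotonicity of [F] enters, which conditional outer
    probabilities also have. *)
Lemma quantile_dist_le (p c e : R) :
  p%:E <= F (c + e)%R -> F (c - e)%R < p%:E -> `|quantile F p - c%:E| <= e%:E.
Proof.
move=> pF Fp.
have : quantile F p <= (c + e)%:E by apply: ereal_inf_lbound; exists (c + e)%R.
have : (c - e)%:E <= quantile F p.
  apply: le_ereal_inf_tmp => _ [y py <-]; rewrite lee_fin leNgt; apply/negP => yc.
  by have := lt_le_trans Fp (le_trans py (F_nd (ltW yc))); rewrite ltxx.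
case: (quantile F p) => [q| |]//; rewrite ?leeNy_eq ?leye_eq//.
rewrite -EFinB !lee_fin => h1 h2; rewrite ler_norml; apply/andP; split; lra.
Qed.

Lemma lt_quantile (p c y : R) : quantile F p = c%:E -> (y < c)%R -> F y < p%:E.
Proof.
move=> qc yc; rewrite ltNge; apply/negP => py.
have : quantile F p <= y%:E by apply: ereal_inf_lbound; exists y.
by rewrite qc lee_fin leNgt yc.
Qed.

(** The infimum gives [p <= F z] for all [z > c], continuity carries this to [p <= F c], and strict
    increase at [c] provides a point between [c] and [y] where [F] exceeds [F c]. *)
Lemma quantile_lt (p c y : R) : (forall x, F x \is a fin_num) ->
  quantile F p = c%:E ->
  {for c, continuous (fine \o F)} -> strictly_increasing_at (fine \o F) c ->
  (c < y)%R -> p%:E < F y.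
Proof.
move=> Ffin qc cF Finc cy.
have gec z : (c < z)%R -> p%:E <= F z.
  rewrite -lte_fin -qc => /ereal_inf_lt[_ [x px <-]]; rewrite lte_fin => xz.
  exact: le_trans px (F_nd (ltW xz)).
have pc : (p <= fine (F c))%R.
  rewrite leNgt; apply/negP => Fcp.
  have : \forall x \near c^'+, (fine (F x) < p)%R.
    by apply: cvg_within; exact: (cvgr_lt _ cF).
  move=> Fxp; near (c^'+) => x.
  have := gec x; rewrite -(fineK (Ffin x)) lee_fin leNgt.
  by move=> /(_ (ltac:(by near: x; exact: nbhs_right_gt)))/negP; apply; near: x.
near (c^'+) => x.
have Fcx : (fine (F c) < fine (F x))%R.
  have [_] : ((x < c -> fine (F x) < fine (F c)) /\
      (c < x -> fine (F c) < fine (F x)))%R.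
    by near: x; apply: cvg_within.
  by apply; near: x; exact: nbhs_right_gt.
apply: (@lt_le_trans _ _ (F x)); last by apply: F_nd; near: x; exact: nbhs_right_le.
by rewrite -(fineK (Ffin x)) lte_fin; exact: le_lt_trans Fcx.
Unshelve. all: by end_near. Qed.

End quantiles.

(** * Eventual bounds from limits and upper limits *)

Lemma cvge_lt (R : realType) (I : Type) (H : set_system I) (f : I -> \bar R)
    (l x : \bar R) :
  f @ H --> l -> l < x -> \forall i \near H, f i < x.
Proof.
move=> fl lx; apply: (fl [set y | y < x]).
by apply: open_nbhs_nbhs; split=> //; exact: open_ereal_lt_ereal.
Qed.

Lemma limn_esup_lt (R : realType) (u : (\bar R)^nat) (l : R) :
  limn_esup u < l%:E -> \forall n \near \oo, u n < l%:E.
Proof.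
move=> /ereal_inf_lt[_ [V Voo <-] Vl]; apply: filterS Voo => n Vn.
by apply: le_lt_trans Vl; apply: ereal_sup_ubound; exists n.
Qed.

Lemma ge0_cvg0 (R : realType) (u : (\bar R)^nat) :
  (forall n, 0 <= u n) ->
  (forall e : R, (0 < e)%R -> \forall n \near \oo, u n < e%:E) -> u @ \oo --> 0.
Proof.
move=> u0 ue; apply: limn_esup_le_cvg => //.
apply/lee_addgt0Pr => e e0; rewrite add0e; apply: ge_ereal_inf.
(* The upper limit is an infimum, over the sets of the filter, of the supremum of [u] there; the set
   where [u n < e] is one of them. *)
exists (ereal_sup [set u n | n in [set n | u n < e%:E]]).
  by exists [set n | u n < e%:E] => //; exact: ue.
by apply: ge_ereal_sup => _ [n /ltW ? <-].
Qed.

(** * Convergence in outer probability of the bootstrap quantile *)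

Theorem corollary3p2 (R : realType) (D : completeNormedModType R)
    (D0 Dphi : set D) (theta0 : D) (phi : D -> R) (alpha : R)
    (d dX dW : measure_display) (Omega : measurableType d)
    (P : probability Omega R)
    (TX : measurableType dX) (TW : measurableType dW)
    (X : forall n : nat, {RV P >-> n.-tuple TX})
    (W : forall n : nat, {RV P >-> n.-tuple TW})
    (d0 : measure_display) (Omega0 : measurableType d0)
    (P0 : probability Omega0 R) (G0 : Omega0 -> D)
    (dphi : D -> R) (r : nat -> R)
    (theta_hat : forall n : nat, n.-tuple TX -> D)
    (theta_star : forall n : nat, n.-tuple TX -> n.-tuple TW -> D)
    (phi_hat : forall n : nat, n.-tuple TX -> D -> R)
    (c : R)
    (Dphi_theta0 : Dphi theta0)
    (alpha01 : (0 < alpha < 1)%R)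
    (G0_borel : borel_random_element G0)
    (phi_hdd : hadamard_directional_derivative Dphi D0 phi theta0 dphi)
    (dphi_continuous : continuous dphi)
    (theta_hat_Dphi : forall n x, Dphi (theta_hat n x))
    (r_incr : nondecreasing_seq r)
    (r_infty : r @ \oo --> +oo%R)
    (theta_hat_weak : weakly_converges P P0
       (fun n omega => r n *: (theta_hat n (X n omega) - theta0))%R G0)
    (G0_tight : tight P0 G0)
    (G0_support : support P0 G0 `<=` D0)
    (theta_star_Dphi : forall n x w, Dphi (theta_star n x w))
    (XW_indep : forall n, independent_RV P (X n) (W n))
    (bootstrap_consistent : cvg_in_outer_probability P
       (fun n omega =>
          ereal_sup [set `| outer_expectation (distribution P (W n))
                        (fun w => (f (r n *: (theta_star n (X n omega) w
                                         - theta_hat n (X n omega))))%R%:E)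
                      - \int[P0]_t (f (G0 t))%:E | | f in BL1 (D:=D)]) 0)
    (bootstrap_asymp_meas : asymptotically_measurable P
       (fun n omega => r n *: (theta_star n (X n omega) (W n omega)
                               - theta_hat n (X n omega)))%R)
    (bootstrap_meas : forall f : D -> R, continuous f -> bounded_fun f ->
       forall n, {ae P, forall omega,
         measurable_fun [set: n.-tuple TW]
           (fun w => f (r n *: (theta_star n (X n omega) w
                                - theta_hat n (X n omega)))%R)})
    (phi_hat_consistent : forall K : set D, compact K -> K `<=` D0 ->
       forall e : R, (0 < e)%R ->
         limn_esup (fun n => outer_probability P
           [set omega | e%:E <
              ereal_sup [set `|phi_hat n (X n omega) h - dphi h|%R%:E
                         | h in enlargement K delta]])
           @[delta --> (0 : R)%R^'+] --> 0)
    (c_quantile :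
       quantile (fun y => P0 [set t | dphi (G0 t) <= y]%R) (1 - alpha) = c%:E)
    (cdf_continuous :
       {for c, continuous (fun y => fine (P0 [set t | dphi (G0 t) <= y]%R))})
    (cdf_increasing :
       strictly_increasing_at
         (fun y => fine (P0 [set t | dphi (G0 t) <= y]%R)) c) :
  cvg_in_outer_probability P
    (fun n omega =>
       quantile
         (fun y => outer_probability (distribution P (W n))
            [set w | phi_hat n (X n omega)
                       (r n *: (theta_star n (X n omega) w
                                - theta_hat n (X n omega))) <= y]%R)
         (1 - alpha))
    c%:E.
Proof.
have /andP[alpha0 alpha1] := alpha01.
pose F y := P0 [set t | dphi (G0 t) <= y]%R.
have mF y : measurable [set t | dphi (G0 t) <= y]%R.
  apply: (measurable_preimage_closed G0_borel (C := dphi @^-1` [set x | x <= y]%R)).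
  by apply: preimage_closed => // x _; exact: dphi_continuous.
have mlt y : measurable [set t | dphi (G0 t) < y]%R.
  apply: (measurable_preimage_open G0_borel (U := dphi @^-1` [set x | x < y]%R)).
  by apply: open_comp => // x _; exact: dphi_continuous.
have Ffin y : F y \is a fin_num by exact: fin_num_measure.
have F_nd (x y : R) : (x <= y)%R -> F x <= F y.
  by move=> xy; apply: le_probability => // t /= tx; exact: le_trans xy.
move=> e e0.
have Fa : F (c - e / 2)%R < (1 - alpha)%:E.
  by apply: (lt_quantile c_quantile); lra.
(* The radius is [e / 4] here because [U1] below is defined by a strict inequality:
   [dphi <= c + e / 4] implies [dphi < c + e / 2]. *)
have Fb : (1 - alpha)%:E < F (c + e / 4)%R.
  by apply: (quantile_lt F_nd Ffin c_quantile) => //; lra.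
move: Fa Fb; rewrite -(fineK (Ffin (c - e / 2)%R)) -(fineK (Ffin (c + e / 4)%R)).
set fa := fine _; set fb := fine _; rewrite !lte_fin => Fa Fb.
(* [tau] is the mass allowed outside [V]. The first bound keeps [fb - tau] above [1 - alpha]. In the
   second, one [tau] pays for [V], one gives the margin in [alpha + tau], and one keeps [PU2]
   strict. *)
pose tau := Num.min ((fb - (1 - alpha)) / 2)%R ((1 - alpha - fa) / 3)%R.
have tau0 : (0 < tau)%R by rewrite lt_min; apply/andP; split; lra.
have tau1 : (1 - alpha < fb - tau)%R.
  have : (tau <= (fb - (1 - alpha)) / 2)%R by rewrite ge_min lexx.
  lra.
have tau2 : (3 * tau <= 1 - alpha - fa)%R.
  have : (tau <= (1 - alpha - fa) / 3)%R by rewrite ge_min lexx orbT.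
  lra.
have [K [cK KS KP]] := tight_compact_in_support G0_borel G0_tight tau0.
have KD0 : K `<=` D0 := subset_trans KS G0_support.
apply: ge0_cvg0 => [n|gamma gamma0]; first exact: outer_probability_ge0.
have e20 : (0 < e / 2)%R by lra.
have gamma20 : (0 < gamma / 2)%R by lra.
(* [delta] is fixed before [n]: the upper limit in [n] is below [gamma / 2] for small [delta], and
   this becomes a bound for all large [n]. *)
have [delta [delta0 /limn_esup_lt hdelta]] : exists delta : R, (0 < delta)%R /\
    limn_esup (fun n => outer_probability P
      [set omega | (e / 2)%:E <
        ereal_sup [set `|phi_hat n (X n omega) h - dphi h|%R%:E
                   | h in enlargement K delta]]) < (gamma / 2)%:E.
  have gamma20E : 0 < (gamma / 2)%:E by rewrite lte_fin.
  have H := cvge_lt (phi_hat_consistent K cK KD0 _ e20) gamma20E.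
  near (0 : R)%R^'+ => delta.
  by exists delta; split; near: delta; [exact: nbhs_right_gt|exact: H].
pose V := enlargement K delta.
have oV : open V := @open_enlargement _ _ K delta.
have mV := measurable_preimage_open G0_borel oV.
have PV := KP V oV (sub_enlargement delta0).
pose U1 := dphi @^-1` [set y | y < c + e / 2]%R `&` V.
pose U2 := dphi @^-1` [set y | c - e / 2 < y]%R `&` V.
have oU1 : open U1.
  by apply: openI => //; apply: open_comp => // x _; exact: dphi_continuous.
have oU2 : open U2.
  by apply: openI => //; apply: open_comp => // x _; exact: dphi_continuous.
have PU1 : (1 - alpha)%:E < P0 (G0 @^-1` U1).
  apply: (@lt_le_trans _ _ (fb - tau)%:E); first by rewrite lte_fin.
  rewrite preimage_setI; apply: le_probabilityI => //; first exact: mlt.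
  rewrite fineK//; apply: le_probability => //; first exact: mlt.
  by move=> t /= tc; apply: le_lt_trans tc _; lra.
have PU2 : (alpha + tau)%:E < P0 (G0 @^-1` U2).
  apply: (@lt_le_trans _ _ (1 - fa - tau)%:E); first by rewrite lte_fin; lra.
  have cpl : G0 @^-1` (dphi @^-1` [set y | c - e / 2 < y]%R) =
      ~` [set t | dphi (G0 t) <= c - e / 2]%R.
    by apply/seteqP; split=> t /=; rewrite ltNge => /negP.
  rewrite preimage_setI cpl; apply: le_probabilityI => //; first exact: measurableC.
  by rewrite probability_setC// -/(F _) -(fineK (Ffin _)).
have [k1 k10 H1] := portmanteau_open G0_borel oU1 PU1.
have [k2 k20 H2] := portmanteau_open G0_borel oU2 PU2.
pose k := Num.min k1 k2.
have kk1 : k%:E <= k1%:E by rewrite lee_fin ge_min lexx.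
have kk2 : k%:E <= k2%:E by rewrite lee_fin ge_min lexx orbT.
have k0 : (0 < k)%R by rewrite lt_min k10.
have gamma20E : 0 < (gamma / 2)%:E by rewrite lte_fin.
have hk := cvge_lt (bootstrap_consistent k k0) gamma20E.
near=> n.
rewrite [X in _ < X%:E](splitr gamma).
(* Two bad events, each of outer probability below [gamma / 2]: [phi_hat] is far from [dphi] on [V],
   or the conditional bootstrap law is far from that of [G0]. *)
apply: le_lt_trans (@outer_probabilityU2 _ _ _ P
  [set omega | (e / 2)%:E < ereal_sup [set `|phi_hat n (X n omega) h - dphi h|%R%:E
     | h in enlargement K delta]]
  [set omega | k%:E < `|ereal_sup [set `| outer_expectation (distribution P (W n))
         (fun w => (f (r n *: (theta_star n (X n omega) w
                               - theta_hat n (X n omega))))%R%:E)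
       - \int[P0]_t (f (G0 t))%:E | | f in BL1 (D:=D)] - 0|]
  _ _ _ _); last 2 first.
- by near: n.
- by near: n; exact: hk.
apply: le_outer_probability => omega /= big.
(* Outside both bad events, [omega] is fixed and the rest is deterministic in the data. *)
apply: contrapT => /not_orP[/negP + /negP].
rewrite -!leNgt sube0 => phi_close /(le_trans (lee_abs _)) BL_close.
have close h : V h -> (`|phi_hat n (X n omega) h - dphi h| <= e / 2)%R.
  move=> Vh; rewrite -lee_fin; apply: le_trans phi_close.
  by apply: ereal_sup_ubound; exists h.
pose Z w := (r n *: (theta_star n (X n omega) w - theta_hat n (X n omega)))%R.
move: big; apply/negP; rewrite -leNgt.
apply: quantile_dist_le.
- move=> x y xy; apply: le_outer_probability => w /= wx; exact: le_trans xy.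
- have [+ _] := H1 _ _ (distribution P (W n)) Z (le_trans BL_close kk1).
  move=> /le_trans; apply; apply: le_outer_probability => w /= [dw /close].
  rewrite ler_norml => /andP[_]; move: dw => /=; lra.
- have [_ +] := H2 _ _ (distribution P (W n)) Z (le_trans BL_close kk2).
  (* The margin [tau] turns the non-strict portmanteau bound into the strict inequality needed at
     [c - e]. *)
  move=> h; apply: (@le_lt_trans _ _ (1 - (alpha + tau))%:E); last by rewrite lte_fin; lra.
  apply: le_trans h; apply: le_outer_probability => w /= wc [dw /close].
  rewrite ler_norml => /andP[+ _]; move: dw wc => /=; lra.
Unshelve. all: by end_near. Qed.
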